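(* Let $(S,\cdot,\ast)$ be a regular $\star$-semigroup. Define a binary operation $+$ on $S$ by $a+b=ab^{\ast}b$ for all $a,b\in S$. Then the map $r_S$ associated to $(S,+,\cdot,\ast)$ is a solution of the Yang-Baxter equation if and only if $(S,\cdot,\ast)$ is completely regular, orthodox and locally inverse.
   Context: A regular $\star$-semigroup is a triple $(S,\cdot,\ast)$ where $(S,\cdot)$ is a semigroup on a non-empty set and $\ast:S\to S$, $x\mapsto x^\ast$, satisfies $xx^\ast x=x$, $(x^\ast)^\ast=x$, $(xy)^\ast=y^\ast x^\ast$ for all $x,y\in S$. It is called completely regular if $a\,\mathcal H\,a^2$ for all $a\in S$ ($\mathcal H=\mathcal L\cap\mathcal R$ being Green's relation), orthodox if the product of any two idempotents is idempotent, and locally inverse if $eSe$ is an inverse semigroup for every idempotent $e$. For a set $S$ with binary operations $+,\cdot$ ($+$ not necessarily associative) and a unary operation $\ast$, the map associated to $(S,+,\cdot,\ast)$ is $r_S:S\times S\to S\times S$, $r_S(a,b)=(a(a^{\ast}+b),\,(a^{\ast}+b)^{\ast}b)$. A map $r:S\times S\to S\times S$ is a (set-theoretic) solution of the Yang-Baxter equation if $(r\times \mathrm{id}_S)(\mathrm{id}_S\times r)(r\times \mathrm{id}_S)=(\mathrm{id}_S\times r)(r\times \mathrm{id}_S)(\mathrm{id}_S\times r)$ as maps $S^3\to S^3$. *)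

(* Defs.v *)
From mathcomp Require Import all_boot.

Set Implicit Arguments.
Unset Strict Implicit.
Unset Printing Implicit Defensive.

Local Open Scope group_scope.

(* The carrier is a [magmaType] together with an associativity axiom, rather
   than a [semigroupType], because the latter forces a [choiceType] structure
   on the carrier; a [magmaType] may live on an arbitrary type. *)
Record regular_star_semigroup (S : magmaType) (star : S -> S) : Prop :=
  RegularStarSemigroup {
    rss_nonempty : inhabited S;
    rss_mulA : forall x y z : S, x * (y * z) = (x * y) * z;
    rss_regular : forall x : S, x * star x * x = x;
    rss_starK : forall x : S, star (star x) = x;
    rss_starM : forall x y : S, star (x * y) = star y * star x
  }.

Section Green.
Variable S : magmaType.
Implicit Types a b x : S.

(* [left_ideal1 a] is S^1 a and [right_ideal1 a] is a S^1; the first disjunct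
   accounts for the adjoined identity of S^1. *)
Definition left_ideal1 a x : Prop := x = a \/ exists s : S, x = s * a.
Definition right_ideal1 a x : Prop := x = a \/ exists s : S, x = a * s.

Definition green_L a b : Prop := forall x, left_ideal1 a x <-> left_ideal1 b x.
Definition green_R a b : Prop := forall x, right_ideal1 a x <-> right_ideal1 b x.
Definition green_H a b : Prop := green_L a b /\ green_R a b.

End Green.

Definition is_idempotent (S : magmaType) (e : S) : Prop := e * e = e.

Definition completely_regular (S : magmaType) : Prop :=
  forall a : S, green_H a (a * a).

Definition orthodox (S : magmaType) : Prop :=
  forall e f : S, is_idempotent e -> is_idempotent f -> is_idempotent (e * f).

Definition is_inverse (S : magmaType) (x y : S) : Prop :=
  x * y * x = x /\ y * x * y = y.

(* Associativity is inherited from S, so a subset T is an inverse semigroup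
   when it is closed under products and each x in T has exactly one inverse
   in T. *)
Definition inverse_subsemigroup (S : magmaType) (T : S -> Prop) : Prop :=
  (forall x y : S, T x -> T y -> T (x * y)) /\
  (forall x : S, T x -> exists! y : S, T y /\ is_inverse x y).

(* The set e S e. *)
Definition local_submonoid (S : magmaType) (e x : S) : Prop :=
  exists s : S, x = e * s * e.

Definition locally_inverse (S : magmaType) : Prop :=
  forall e : S, is_idempotent e -> inverse_subsemigroup (local_submonoid e).

(* The map r_S associated to (S, add, *, star). *)
Definition associated_map (S : magmaType) (add : S -> S -> S) (star : S -> S)
    (p : S * S) : S * S :=
  let: (a, b) := p in (a * add (star a) b, star (add (star a) b) * b).

(* S^3 is the left-nested product S * S * S; [on12 r] is r x id and [on23 r] is
   id x r on it. *)
Definition on12 (S : Type) (r : S * S -> S * S) (t : S * S * S) : S * S * S :=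
  let: (a, b, c) := t in let: (a', b') := r (a, b) in (a', b', c).

Definition on23 (S : Type) (r : S * S -> S * S) (t : S * S * S) : S * S * S :=
  let: (a, b, c) := t in let: (b', c') := r (b, c) in (a, b', c').

Definition yang_baxter_solution (S : Type) (r : S * S -> S * S) : Prop :=
  on12 r \o on23 r \o on12 r =1 on23 r \o on12 r \o on23 r.

(* Main.v *)
(* Write p = a a^* and q = a^* a.  The map is r(a, b) = (p_a q_b, q_b a b), so
   the braid relation is a system of three identities in S.
   If they hold, the first one at b = c = a^* gives p q p = p, i.e. complete
   regularity, and the first and third ones on projections give e f g = e g f g.
   As every idempotent is a product of two projections, all idempotents then
   satisfy e x y f = e y x f, which yields orthodoxy and local inversity.
   Conversely, the idempotents of an orthodox locally inverse semigroup form a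
   normal band (e x y f = e y x f); complete regularity gives e p f = e q f and
   hence x g x^* = p_x g p_x for projections g.  This turns the three identities
   into identities between words in the p's and q's with the same end letters and
   the same content, and such words are equal in a normal band. *)
Require Import Defs.
From mathcomp Require Import all_boot.

Set Implicit Arguments.
Unset Strict Implicit.
Unset Printing Implicit Defensive.

Local Open Scope group_scope.

Section RegularStar.
Variables (S : magmaType) (star : S -> S).
Hypothesis hS : regular_star_semigroup star.
Implicit Types a b c e f g x y z : S.

Let mulA := rss_mulA hS.
Let regular := rss_regular hS.
Let starK := rss_starK hS.
Let starM := rss_starM hS.

Local Notation p x := (x * star x).
Local Notation q x := (star x * x).
Local Notation r :=
  (associated_map (fun a b : S => a * star b * b) star).

(** * Projections, and the braid relation written out in components *)

Definition projection e := e * e = e /\ star e = e.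

Lemma star_regular x : star x * x * star x = star x.
Proof. by rewrite -{2}(starK x) regular. Qed.

Lemma projection_p x : projection (p x).
Proof. by split; rewrite ?starM ?starK // mulA regular. Qed.

Lemma projection_q x : projection (q x).
Proof. by split; rewrite ?starM ?starK // mulA star_regular. Qed.

Lemma idem_p x : is_idempotent (p x). Proof. by case: (projection_p x). Qed.
Lemma idem_q x : is_idempotent (q x). Proof. by case: (projection_q x). Qed.

Lemma p_proj e : projection e -> p e = e. Proof. by case=> ee ->. Qed.
Lemma q_proj e : projection e -> q e = e. Proof. by case=> ee ->. Qed.

(** For [x = e * f] the law [x * star x * x = x] reads [e f f e e f = e f]. *)
Lemma proj_mul_idem e f : projection e -> projection f ->
  is_idempotent (e * f).
Proof.
move=> [ee se] [ff sf]; have := regular (e * f).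
by rewrite starM se sf !mulA -(mulA e f f) ff -(mulA (e * f) e e) ee -mulA.
Qed.

Lemma idem_pq e : is_idempotent e -> e = p e * q e.
Proof. by move=> ee; rewrite mulA -(mulA e) -starM ee regular. Qed.

Lemma p_mul x y : p (x * y) = x * p y * star x.
Proof. by rewrite starM !mulA. Qed.

Lemma q_mul x y : q (x * y) = star y * q x * y.
Proof. by rewrite starM !mulA. Qed.

Lemma p_pq a b : p (p a * q b) = p a * q b * p a.
Proof.
by rewrite p_mul (p_proj (projection_q b)) (projection_p a).2.
Qed.

Lemma q_pq a b : q (p a * q b) = q b * p a * q b.
Proof.
by rewrite q_mul (q_proj (projection_p a)) (projection_q b).2.
Qed.

Lemma associated_mapE a b : r (a, b) = (p a * q b, q b * a * b).
Proof. by rewrite /= !starM !starK !mulA. Qed.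

(** The three components of both composites, multiplied out until [p] and [q] apply to [a], [b], [c]
    only. *)
Definition braid_equations a b c : Prop :=
  [/\ p a * q b * p a * (q c * (q b * a * p b * star a * q b) * q c)
      = p a * (q c * p b * q c),
      q c * (q b * a * p b * star a * q b) * q c * (p a * q b)
        * (q b * a * p b * star a * q b * q c)
      = q c * p b * q c * a * (p b * q c * p b) * star a * (q c * p b * q c)
        * (star c * (star b * q c * b) * c)
    & q c * (q b * a * b) * c
      = star c * (star b * q c * b) * c * (q c * p b * q c * a * (p b * q c))
        * (q c * b * c)].

Lemma proj_conj e f : projection e -> projection f -> projection (e * f * e).
Proof.
move=> pe pf; split; last by rewrite !starM pe.2 pf.2 mulA.
have := proj_mul_idem pe pf; rewrite /is_idempotent !mulA => efef.
by rewrite -(mulA _ e e) pe.1 efef.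
Qed.

Lemma braid_equationsP a b c :
  (on12 r \o on23 r \o on12 r) (a, b, c)
   = (on23 r \o on12 r \o on23 r) (a, b, c) <-> braid_equations a b c.
Proof.
have p_conj e x y : projection e -> p (e * x * y) = e * x * p y * star x * e.
  by case=> _ se; rewrite !starM se !mulA.
have q_conj e x y : projection e -> q (e * x * y) = star y * (star x * e * x) * y.
  by case=> ee se; rewrite !starM se !mulA -(mulA _ e e) ee.
have [pp pq] := (projection_p, projection_q).
have pqpq := proj_conj (pq c) (pp b).
rewrite /comp /on12 /on23 !associated_mapE !p_pq !q_pq.
rewrite (p_conj _ a (p b * q c) pqpq) (p_conj _ _ _ (pq b)).
rewrite (q_conj _ _ _ (pq c)) p_pq.
by split=> [[]|[-> -> ->]].
Qed.

(** * Criteria for the three properties; [medial] is the normal band law *)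

Definition medial : Prop := forall e x y f : S,
  is_idempotent e -> is_idempotent x -> is_idempotent y -> is_idempotent f ->
  e * x * y * f = e * y * x * f.

Lemma green_H_square a s t : a = s * (a * a) -> a = a * a * t ->
  green_H a (a * a).
Proof.
move=> aL aR; split=> x; split=> [[->|[u ->]]|[->|[u ->]]]; right.
- by exists s.
- by exists (u * s); rewrite -mulA -aL.
- by exists a.
- by exists (u * a); rewrite mulA.
- by exists t.
- by exists (t * u); rewrite mulA -aR.
- by exists a.
- by exists (a * u); rewrite mulA.
Qed.

(** Inserting [p = p q p] into [a = p a * a] gives [a = p a * q a * a], which ends in [a * a]; the
    same law at [star a] gives [a = a * p a * q a], which begins with it. *)
Lemma pqp_completely_regular :
  (forall a, p a * q a * p a = p a) -> completely_regular S.
Proof.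
move=> pqp a.
apply: (@green_H_square a (a * star a * star a) (star a * star a * a)).
  have aL : a = p a * q a * a.
    by rewrite -{1}(regular a) -{1}(pqp a) -(mulA _ (p a)) regular.
  by rewrite {1}aL !mulA.
have qpq := pqp (star a); rewrite !starK in qpq.
have aR : a = a * (p a * q a).
  by rewrite -{1}(regular a) -mulA -{1}qpq -(mulA (q a)) (mulA a (q a))
    (mulA a (star a)) regular.
by rewrite {1}aR !mulA.
Qed.

Lemma medial_orthodox : medial -> orthodox S.
Proof.
by move=> med e f ee ff; rewrite /is_idempotent !mulA -(med e e) // ee -mulA ff.
Qed.

(** Mediality with [e] at both ends makes the idempotents of [e S e] commute, so inverses there are
    unique; [e * star x * e] is one. *)
Lemma medial_locally_inverse : medial -> locally_inverse S.
Proof.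
move=> med e ee.
have eT x : local_submonoid e x -> e * x = x /\ x * e = x.
  by case=> s ->; split; rewrite ?mulA ?ee // -mulA ee.
have Te x : e * x = x -> x * e = x -> local_submonoid e x.
  by move=> ex xe; exists x; rewrite ex xe.
have comm i j : local_submonoid e i -> local_submonoid e j ->
    is_idempotent i -> is_idempotent j -> i * j = j * i.
  move=> /eT[ei ie] /eT[ej je] ii jj.
  by have := med _ _ _ _ ee ii jj ee; rewrite -!mulA ie je !mulA ei ej.
split=> [x y /eT[ex xe] /eT[ey ye]|x /eT[ex xe]].
  by apply: Te; rewrite ?mulA ?ex // -mulA ye.
have inv : is_inverse x (e * star x * e).
  split; first by rewrite !mulA xe -(mulA _ e x) ex regular.
  rewrite !mulA -(mulA _ e x) ex -(mulA _ x e) xe -(mulA e _ x).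
  by rewrite -(mulA e _ (star x)) star_regular.
exists (e * star x * e); split; first by split; first by exists (star x).
have idem_mul y z : y * z * y = y -> is_idempotent (y * z).
  by move=> yzy; rewrite /is_idempotent mulA yzy.
have T_mul y z : e * y = y -> z * e = z -> local_submonoid e (y * z).
  by move=> ey ze; apply: Te; rewrite ?mulA ?ey // -mulA ze.
have unique y z : local_submonoid e y -> local_submonoid e z ->
    is_inverse x y -> is_inverse x z -> y = z.
  move=> /eT[ey ye] /eT[ez ze] [xyx yxy] [xzx zxz].
  have yz : y * x = z * x.
    by rewrite -{1}xzx !mulA -(mulA (y * x)) comm ?mulA ?xyx //;
      [rewrite -!mulA (mulA x) xyx | exact: T_mul | exact: T_mul
      | exact: idem_mul | exact: idem_mul].
  have xyz : x * y = x * z.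
    by rewrite -{1}xzx -(mulA _ x y) comm ?mulA ?xyx //;
      [exact: T_mul | exact: T_mul | exact: idem_mul | exact: idem_mul].
  by rewrite -yxy yz -mulA xyz mulA.
by move=> y [Ty xy]; apply: unique xy => //; exists (star x).
Qed.

(** * From the braid relation to mediality *)

Section FromBraid.
Hypothesis braid : forall a b c, braid_equations a b c.

Lemma braid_pqp a : p a * q a * p a = p a.
Proof.
have [E _ _] := braid a (star a) (star a); move: E.
rewrite !starK !idem_p regular (mulA a (star a) a) regular !idem_p.
by rewrite (mulA (p a) (p a * q a)) (mulA (p a) (p a) (q a)) idem_p => <-.
Qed.

(** Regularity gives [e f g = e f g f e f g]. The third identity at [(g, f, e)] is
    [e f g f e = e f e g f e], and the first at [(e, f, g)] is [e f e g f e f g = e g f g]. *)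
Lemma braid_proj_absorb e f g : projection e -> projection f -> projection g ->
  e * f * g = e * g * f * g.
Proof.
move=> pe pf pg.
have id1 z x : projection x -> z * x * x = z * x by case=> xx _; rewrite -mulA xx.
have id2 z x y : projection x -> projection y -> z * x * y * x * y = z * x * y.
  move=> px py; have := proj_mul_idem px py.
  by rewrite -!mulA /is_idempotent -!mulA => ->.
have [E1 _ _] := braid e f g; have [_ _ E3] := braid g f e.
move: E1 E3; rewrite !(p_proj, q_proj) // ?pe.2 ?pf.2 ?pg.2 !mulA !(id1, id2) //.
move=> E1 E3; have := regular (e * f * g).
by rewrite !starM pe.2 pf.2 pg.2 !mulA !id1 // E3 E1.
Qed.

(** Absorption turns [e x y] into [e y x y]; its image under [star] turns [y x y f] into [y x f]. *)
Lemma braid_proj_medial e x y f :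
  projection e -> projection x -> projection y -> projection f ->
  e * x * y * f = e * y * x * f.
Proof.
move=> pe px py pf.
have absorb_star a b c : projection a -> projection b -> projection c ->
    a * b * c = a * b * a * c.
  move=> pa pb pc; have := congr1 star (braid_proj_absorb pc pb pa).
  by rewrite !starM pa.2 pb.2 pc.2 !mulA.
rewrite (braid_proj_absorb pe px py) -!mulA (mulA y) (mulA (y * x)) -absorb_star //.
by rewrite !mulA.
Qed.

Lemma braid_medial : medial.
Proof.
move=> e x y f /idem_pq-> /idem_pq-> /idem_pq-> /idem_pq->.
have med z a b c d : projection a -> projection b -> projection c -> projection d ->
    z * a * b * c * d = z * a * c * b * d.
  by move=> *; rewrite -!(mulA z) braid_proj_medial.
have [pp pq] := (projection_p, projection_q).
move: (pp e) (pq e) (pp x) (pq x) (pp y) (pq y) (pp f) (pq f).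
move: (p e) (q e) (p x) (q x) (p y) (q y) (p f) (q f).
move=> e1 e2 x1 x2 y1 y2 f1 f2 *; rewrite !mulA; congr (_ * _).
(* Four adjacent swaps carry [x1 x2 y1 y2] to [y1 y2 x1 x2]. *)
rewrite (med _ x1 x2 y1 y2) // (med _ e2 x1 y1 x2) //.
by rewrite (med _ x1 x2 y2 f1) // (med _ y1 x1 y2 x2).
Qed.

End FromBraid.

(** * From the three properties to a normal band of idempotents *)

Section ToBraid.
Hypotheses (cr : completely_regular S) (orth : orthodox S).
Hypothesis li : locally_inverse S.

(** Since [b] lies in [b * b * S], the projections [p (b * b)] and [p b] agree. Multiplying by
    [star b] on the left and [b] on the right gives [q p q = q], used at [b = star a]. *)
Lemma cr_pqp a : p a * q a * p a = p a.
Proof.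
have cr_qpq b : q b * p b * q b = q b.
  have [s bs] : exists s, b = b * b * s.
    have [_ /(_ b)[]] := cr b; case=> [|bb|//]; first by left.
    by exists b; rewrite -!bb.
  have pbb : p (b * b) = p b.
    have E : p (b * b) * p b = p b.
      by rewrite mulA {5}bs (mulA (p (b * b)) (b * b) s) regular -bs.
    have := congr1 star E; rewrite starM !(projection_p _).2 => <-.
    by rewrite starM !mulA regular.
  have := congr1 (fun z => star b * z * b) pbb.
  by rewrite starM !mulA star_regular.
by have := cr_qpq (star a); rewrite !starK.
Qed.

(** With [i = e f e] and [j = e g e], orthodoxy makes both [i j] and [j i] inverses of [i j] inside
    [e S e], so they coincide. *)
Lemma locally_inverse_comm e f g :
  is_idempotent e -> is_idempotent f -> is_idempotent g ->
  e * f * e * (e * g * e) = e * g * e * (e * f * e).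
Proof.
move=> ee ff gg; have [T_mul T_inv] := li ee.
have idem h : is_idempotent h -> is_idempotent (e * h * e).
  by move=> hh; apply: orth => //; apply: orth.
have Tf : local_submonoid e (e * f * e) by exists f.
have Tg : local_submonoid e (e * g * e) by exists g.
move: Tf Tg (idem _ ff) (idem _ gg); move: (e * f * e) (e * g * e).
move=> i j Ti Tj ii jj.
have ij := orth ii jj; have ji := orth jj ii.
have [y [_ uniq_y]] := T_inv _ (T_mul _ _ Ti Tj).
rewrite -(uniq_y (i * j)); last by split; [exact: T_mul | split; rewrite !ij].
apply: uniq_y; split; first exact: T_mul.
split; rewrite !mulA.
  by rewrite -(mulA i j j) jj -(mulA (i * j) i i) ii -mulA ij.
by rewrite -(mulA j i i) ii -(mulA (j * i) j j) jj -mulA ji.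
Qed.

(* [e f g e] lies below [e f e g e] in the local semilattice at [e], and the two
   generate the same two-sided ideal. *)
Lemma band_absorb e f g :
  is_idempotent e -> is_idempotent f -> is_idempotent g ->
  e * f * g * e = e * f * e * g * e.
Proof.
move=> ee ff gg.
set x := e * f * g * e; set y := e * f * e * g * e.
have xx : is_idempotent x by do !apply: orth.
have yy : is_idempotent y by do !apply: orth.
have ex : e * x = x by rewrite /x !mulA ee.
have xe : x * e = x by rewrite /x -mulA ee.
have ef := orth ee ff; have ge := orth gg ee.
have xy : x * y = x.
  have := locally_inverse_comm ee xx ff; rewrite ex xe => xef.
  have -> : y = e * f * e * (e * g * e) by rewrite /y !mulA -(mulA _ e e) ee.
  rewrite mulA xef.
  have -> : e * f * e * x = x.
    by rewrite /x !mulA -(mulA _ e e) ee -(mulA _ e f) ef.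
  by rewrite /x !mulA -(mulA _ e e) ee -!mulA (mulA g e (g * e)) ge.
have yx : y * x = x.
  have := locally_inverse_comm ee yy xx.
  have [-> ->] : e * x * e = x /\ e * y * e = y; last by rewrite xy.
  by rewrite ex xe /y !mulA ee -mulA ee.
have gef : is_idempotent (g * e * f) by do !apply: orth.
(* [y * x * y] is [y * y] with the inner factor [g * e * f] repeated. *)
suff yxy : y * x * y = y by rewrite -yxy yx xy.
rewrite -[RHS]yy /x /y !mulA -!(mulA _ e e) ee.
by rewrite -!(mulA _ g e) -!(mulA _ (g * e) f) -(mulA _ (g * e * f) (g * e * f))
  gef.
Qed.

(** The swap is first obtained in words that begin and end with the same idempotent. Squaring
    [e x y f] exposes two of these, [e x y f e] and [f e x y f]; swapping in both yields the square
    of [e y x f]. *)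
Lemma band_medial : medial.
Proof.
have comm e x y : is_idempotent e -> is_idempotent x -> is_idempotent y ->
    e * x * y * e = e * y * x * e.
  move=> ee xx yy; rewrite !band_absorb //.
  have := locally_inverse_comm ee xx yy.
  by rewrite !mulA -!(mulA _ e e) ee.
have comm_l e x y f : is_idempotent e -> is_idempotent x -> is_idempotent y ->
    is_idempotent f -> e * x * y * f * e = e * y * x * f * e.
  move=> ee xx yy ff; have [xy yx] := (orth xx yy, orth yy xx).
  by rewrite -(mulA e x) -(mulA e y) !band_absorb // !mulA comm.
have comm_r f z x y : is_idempotent f -> is_idempotent z -> is_idempotent x ->
    is_idempotent y -> f * z * x * y * f = f * z * y * x * f.
  move=> ff zz xx yy; have [xy yx] := (orth xx yy, orth yy xx).
  rewrite -(mulA (f * z) x) -(mulA (f * z) y) !band_absorb //.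
  by rewrite -!(mulA (f * z)) (mulA f x) (mulA f y) comm.
move=> e x y f ee xx yy ff.
have uu : is_idempotent (e * x * y * f) by do !apply: orth.
have vv : is_idempotent (e * y * x * f) by do !apply: orth.
rewrite -uu -[RHS]vv !mulA comm_l //.
by have := comm_r f e x y ff ee xx yy; rewrite -!mulA => ->.
Qed.

(** Expanding [p = p q p] and [q = q p q], mediality reduces the two sides to [e p q f] and
    [e q p f], which are equal. *)
Lemma band_pq e f a : is_idempotent e -> is_idempotent f ->
  e * p a * f = e * q a * f.
Proof.
move=> ee ff; have [ia iq] := (@idem_p a, @idem_q a).
have qpq := cr_pqp (star a); rewrite !starK in qpq.
have -> : e * p a * f = e * p a * q a * f.
  rewrite -{1}cr_pqp -!(mulA (e * _)) (mulA e (p a * q a)) (mulA e (p a)).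
  by rewrite (band_medial (orth ee ia) iq ia ff) -(mulA e (p a) (p a)) ia.
rewrite (band_medial ee ia iq ff) -{2}qpq.
by rewrite (mulA e (q a * p a)) (mulA e (q a)) (band_medial (orth ee iq) ia iq ff)
  -(mulA e (q a) (q a)) iq.
Qed.

(** For the projection [f = q x * g * q x], the element [x * f] has [p (x * f) = x * g * star x] and
    [q (x * f) = f], so [band_pq] exchanges the two between copies of [p x]. *)
Lemma conj_proj x g : projection g -> x * g * star x = p x * g * p x.
Proof.
move=> [gg sg]; set f := q x * g * q x.
have [ip iq] := (@idem_p x, @idem_q x).
have ff : is_idempotent f by exact: orth (orth iq gg) iq.
have sf : star f = f by rewrite /f !starM starK sg !mulA.
have pxf : p (x * f) = x * g * star x.
  by rewrite p_mul sf ff /f !mulA regular -!mulA (mulA (star x)) star_regular.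
have qxf : q (x * f) = f.
  by rewrite q_mul sf (_ : f * q x = f) // /f -mulA iq.
have -> : x * g * star x = p x * p (x * f) * p x.
  by rewrite pxf !mulA regular -!mulA (mulA (star x)) star_regular.
rewrite band_pq // qxf /f (mulA (p x)) (mulA (p x) (q x) g).
rewrite -(band_pq _ (orth (orth ip iq) gg) ip) -(mulA _ (p x) (p x)) ip.
by rewrite -(mulA _ g) -(band_pq _ ip (orth gg ip)) ip mulA.
Qed.

(** * Equality of words in the normal band *)

Section Words.
Variable x : nat -> S.

Definition letter (l : bool * nat) : S := if l.1 then p (x l.2) else q (x l.2).
(** The fold ends in a factor [f] because [S] need not have an identity. *)
Definition word (s : seq (bool * nat)) (f : S) : S :=
  foldr (fun l => mul (letter l)) f s.

Lemma idem_letter l : is_idempotent (letter l).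
Proof. by case: l => [[] i]; [exact: idem_p | exact: idem_q]. Qed.

Lemma idem_word s f : is_idempotent f -> is_idempotent (word s f).
Proof.
by move=> ff; elim: s => //= l s; apply: orth; exact: idem_letter.
Qed.

Lemma letter_swap e l m f : is_idempotent e -> is_idempotent f ->
  e * (letter l * (letter m * f)) = e * (letter m * (letter l * f)).
Proof.
by move=> ee ff; have := band_medial ee (idem_letter l) (idem_letter m) ff;
  rewrite !mulA.
Qed.

(** The letter is swapped rightwards up to a letter of the same index, made equal to it by
    [band_pq], and merged by idempotency. *)
Lemma word_absorb e l s f : is_idempotent e -> is_idempotent f ->
  l.2 \in map snd s -> e * (letter l * word s f) = e * word s f.
Proof.
elim: s e => //= m s IH e ee ff; have ws := idem_word s ff; rewrite inE.
case/predU1P=> [lm|ls]; last first.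
  by rewrite letter_swap // !mulA -!(mulA (e * _)) IH //; exact: orth (idem_letter m).
have -> : e * (letter l * (letter m * word s f))
          = e * (letter m * (letter m * word s f)).
  have wm := orth (idem_letter m) ws.
  move: (band_pq (x m.2) ee wm); rewrite /letter lm.
  by case: l.1; case: m.1 => //; rewrite !mulA.
by rewrite (mulA (letter m)) idem_letter.
Qed.

Lemma word_pull e l s f : is_idempotent e -> is_idempotent f ->
  e * word s (letter l * f) = e * (letter l * word s f).
Proof.
elim: s e => //= m s IH e ee ff.
rewrite mulA IH ?(orth ee (idem_letter m)) //; last exact: orth (idem_letter m).
by rewrite -mulA letter_swap //; exact: idem_word.
Qed.

Lemma word_cat s t f : word (s ++ t) f = word s (word t f).
Proof. exact: foldr_cat. Qed.

Lemma word_cat_subl e s t f : is_idempotent e -> is_idempotent f ->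
  {subset map snd s <= map snd t} -> e * word s (word t f) = e * word t f.
Proof.
move=> ee ff; elim: s => //= l s IH st; rewrite -word_cat word_absorb //.
  by rewrite word_cat IH // => i si; apply: st; rewrite inE si orbT.
by rewrite map_cat mem_cat st ?orbT // mem_head.
Qed.

Lemma word_cat_subr e s t f : is_idempotent e -> is_idempotent f ->
  {subset map snd s <= map snd t} -> e * word t (word s f) = e * word t f.
Proof.
move=> ee ff; elim: s => //= l s IH st.
rewrite word_pull //; last exact: idem_word.
rewrite -word_cat word_absorb //.
  by rewrite word_cat IH // => i si; apply: st; rewrite inE si orbT.
by rewrite map_cat mem_cat st // mem_head.
Qed.

(* The content of a word forgets the flag of each letter: [band_pq] lets [p x] and
   [q x] replace each other inside a word. *)
Lemma word_eq l m s t (cs := map snd (l :: rcons s m))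
    (ct := map snd (l :: rcons t m)) :
  all [in ct] cs && all [in cs] ct ->
  letter l * word s (letter m) = letter l * word t (letter m).
Proof.
have [ll mm] := (idem_letter l, idem_letter m).
have pad u : letter l * word u (letter m) = letter l * word (l :: rcons u m) (letter m).
  by rewrite /= mulA ll /word foldr_rcons mm.
case/andP=> /allP st /allP ts.
(* The padded [t] is inserted before the padded [s], which is then deleted as a redundant tail. *)
rewrite pad (pad t) -(word_cat_subl (s := l :: rcons t m)) //.
by rewrite word_cat_subr.
Qed.

End Words.

(** * Verification of the three braid identities *)

Local Notation P_ i := (true, i%N).
Local Notation Q_ i := (false, i%N).

Lemma braid_equations_of_band a b c : braid_equations a b c.
Proof.
have K x g z : projection g -> z * x * g * star x = z * p x * g * p x.
  by move=> pg; rewrite -!(mulA z) conj_proj // !mulA.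
have K' x g : projection g -> star x * g * x = q x * g * q x.
  by move=> pg; have := conj_proj (star x) pg; rewrite !starK.
have [pp pq] := (projection_p, projection_q).
have Ep := proj_conj (pp b) (pq c).
(* Indices 0, 1, 2 stand for [a], [b], [c]; below, [isT] discharges the content condition by
   computation. *)
have weq := @word_eq (nth a [:: a; b; c]).
split.
- rewrite K //.
  have := weq (P_ 0) (Q_ 2)
    [:: Q_ 1; P_ 0; Q_ 2; Q_ 1; P_ 0; P_ 1; P_ 0; Q_ 1]
    [:: Q_ 2; P_ 1] isT.
  rewrite /= /letter /=.
  by move: (p a) (q b) (q c) (p b) => e f g h; rewrite !mulA.
- rewrite !K // (K' b) // (K' c); last exact: proj_conj.
  have := weq (Q_ 2) (Q_ 2)
    [:: Q_ 1; P_ 0; P_ 1; P_ 0; Q_ 1; Q_ 2; P_ 0; Q_ 1; Q_ 1; P_ 0; P_ 1; P_ 0;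
        Q_ 1]
    [:: P_ 1; Q_ 2; P_ 0; P_ 1; Q_ 2; P_ 1; P_ 0; Q_ 2; P_ 1; Q_ 2; Q_ 2; Q_ 1;
        Q_ 2; Q_ 1] isT.
  rewrite /= /letter /=.
  by move: (p a) (q b) (q c) (p b) => e f g h; rewrite !mulA.
(* In the third identity [a], [b], [c] also occur without a matching star. Both sides are brought to
   a word times [a * b * c], and [mE] then gives the two words the common last letter [p a]. *)
have pbc : p (b * c) = p b * q c * p b.
  by rewrite p_mul conj_proj // band_pq //; exact: idem_p.
have bcE : p b * q c * (b * c) = b * c.
  by rewrite -[RHS]regular pbc -(mulA _ (p b)) (mulA (p b) b c) regular.
have mE : p a * (p b * q c * p b) * p a * (a * b * c) = a * b * c.
  by rewrite -conj_proj // -pbc -p_mul -(mulA a b c) regular.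
rewrite (K' b) // (K' c); last exact: proj_conj.
have -> : q c * (q b * a * b) * c = q c * q b * (a * b * c) by rewrite !mulA.
set X := q c * p b * q c; set Y := q c * _ * q c.
have -> : Y * (X * a * (p b * q c)) * (q c * b * c) = Y * X * (a * b * c).
  rewrite -(mulA (q c) b c) -(mulA Y) (mulA _ (q c) (b * c)).
  rewrite -(mulA (X * a) _ (q c)) -(mulA (p b) (q c) (q c)) idem_q.
  by rewrite -(mulA (X * a)) bcE !mulA.
rewrite -mE !(mulA _ _ (a * b * c)); congr (_ * _); rewrite /X /Y.
have := weq (Q_ 2) (P_ 0) [:: Q_ 1; P_ 0; P_ 1; Q_ 2; P_ 1]
  [:: Q_ 1; Q_ 2; Q_ 1; Q_ 2; Q_ 2; P_ 1; Q_ 2; P_ 0; P_ 1; Q_ 2; P_ 1] isT.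
rewrite /= /letter /=.
by move: (p a) (q b) (q c) (p b) => e f g h; rewrite !mulA.
Qed.

End ToBraid.
End RegularStar.

Theorem proposition4p7 (S : magmaType) (star : S -> S)
    (hS : regular_star_semigroup star) :
  yang_baxter_solution
    (associated_map (fun a b : S => (a * star b * b)%g) star) <->
  completely_regular S /\ orthodox S /\ locally_inverse S.
Proof.
split=> [ybe|[cr [orth li]] [[a b] c]].
  have braid a b c : braid_equations star a b c by apply/braid_equationsP.
  have med := braid_medial hS braid.
  split; first exact/(pqp_completely_regular hS)/(braid_pqp hS braid).
  by split; [exact: (medial_orthodox hS) | exact: (medial_locally_inverse hS)].
by apply/(braid_equationsP hS)/braid_equations_of_band.
Qed.
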